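(* Let $d\in\mathbb N$, $\alpha\in(0,2)$, $m\ge0$, and $v,a>0$ be such that $\mathcal H_{m,\alpha}=\Phi_{m,\alpha}(-\Delta)-v\mathbf 1_{B_a}$ has a ground state $\varphi$. Let $(\varepsilon_k)_{k\in\mathbb N}$, $\varepsilon_k\downarrow0$, be a sequence such that the ground states $\varphi_k:=\varphi_{\varepsilon_k}$ and ground state eigenvalues $\lambda_{\varepsilon_k}$ of $\mathcal H^{\varepsilon_k}_{m,\alpha}=\Phi_{m,\alpha}(-\Delta)-v\eta_{\varepsilon_k}$ satisfy $\varphi_k\to\varphi$ in $L^2(\mathbb R^d)$ and almost everywhere, and $\lambda_{\varepsilon_k}\to\lambda$. Then $\Phi_{m,\alpha}(-\Delta)\varphi\in L^2(\mathbb R^d)$ and $\Phi_{m,\alpha}(-\Delta)\varphi_k\to\Phi_{m,\alpha}(-\Delta)\varphi$ in $L^2(\mathbb R^d)$ as $k\to\infty$.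
   Context: $B_r$ is the ball of radius $r$ centred at the origin in $\mathbb R^d$. $\Phi_{m,\alpha}(z)=(z+m^{2/\alpha})^{\alpha/2}-m$, $z>0$, and $\Phi_{m,\alpha}(-\Delta)$ is the self-adjoint operator on $L^2(\mathbb R^d)$ given by the Fourier multiplier $\Phi_{m,\alpha}(|\xi|^2)$; in $L^2$ sense $\Phi_{m,\alpha}(-\Delta)u=\mathcal F^{-1}[\Phi_{m,\alpha}(|\cdot|^2)\widehat u]$. Let $\varrho(x)=C_\varrho e^{-1/(1-|x|^2)}$ for $|x|<1$, $\varrho(x)=0$ otherwise, with $\int\varrho=1$; $\varrho_{\varepsilon/2}(x)=(2/\varepsilon)^d\varrho(2x/\varepsilon)$; $\eta_\varepsilon=\varrho_{\varepsilon/2}*\mathbf 1_{B_{a+\varepsilon/2}}$ for $\varepsilon>0$, a smooth radially non-increasing cutoff equal to $1$ on $B_a$ and $0$ outside $B_{a+\varepsilon}$. Put $V=-v\mathbf 1_{B_a}$, $V_\varepsilon=-v\eta_\varepsilon$, $\mathcal H_{m,\alpha}=\Phi_{m,\alpha}(-\Delta)+V$, $\mathcal H^\varepsilon_{m,\alpha}=\Phi_{m,\alpha}(-\Delta)+V_\varepsilon$, self-adjoint on $L^2(\mathbb R^d)$ with essential spectrum $[0,\infty)$. Such an operator has a ground state if its discrete spectrum is non-empty; the minimum of the discrete spectrum is then a simple eigenvalue (ground state eigenvalue) and the ground state is the unique corresponding strictly positive eigenfunction with $L^2$-norm 1, taken in its continuous version. Standing assumption: $v$ is such that $\mathcal H_{m,\alpha}$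 and every $\mathcal H^\varepsilon_{m,\alpha}$ have ground states, denoted $\varphi$, $\varphi_\varepsilon$, with eigenvalues $\lambda$, $\lambda_\varepsilon$. *)

(* Defs.v *)
From HB Require Import structures.
From mathcomp Require Import all_boot all_order all_algebra.
From mathcomp Require Import all_classical all_reals all_analysis.
From mathcomp Require Import complex.

Set Implicit Arguments.
Unset Strict Implicit.
Unset Printing Implicit Defensive.
Import Order.TTheory GRing.Theory Num.Theory.
Import numFieldNormedType.Exports.
Local Open Scope classical_set_scope.
Local Open Scope complex_scope.
Local Open Scope ring_scope.

Definition rV_display : measure_display.
Proof. exact: default_measure_display. Qed.

Section measurable_rV.
Context (R : realType) (n : nat).

Let coord (i : 'I_n) (x : 'rV[R]_n) : measurableTypeR R := x ord0 i.

Let rV_set0 : g_sigma_preimage coord set0.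
Proof. exact: sigma_algebra0. Qed.

Let rV_setC A : g_sigma_preimage coord A -> g_sigma_preimage coord (~` A).
Proof. exact: sigma_algebraC. Qed.

Let rV_bigcup (F : (set 'rV[R]_n)^nat) :
  (forall i, g_sigma_preimage coord (F i)) ->
  g_sigma_preimage coord (\bigcup_i (F i)).
Proof. exact: sigma_algebra_bigcup. Qed.

HB.instance Definition _ := @isMeasurable.Build rV_display
  'rV[R]_n (g_sigma_preimage coord) rV_set0 rV_setC rV_bigcup.

Lemma measurable_coord (i : 'I_n) :
  measurable_fun [set: 'rV[R]_n] (fun x => x ord0 i : measurableTypeR R).
Proof.
move=> _ Y mY; rewrite setTI; apply: sub_sigma_algebra => /=.
rewrite -bigcup_seq/=; exists i => /=; first by rewrite mem_index_enum.
by exists Y => //; rewrite setTI.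
Qed.

Lemma measurable_fun_rV d (T : measurableType d) (f : T -> 'rV[R]_n) :
  (forall i, measurable_fun [set: T] (fun x => f x ord0 i : measurableTypeR R)) ->
  measurable_fun [set: T] f.
Proof.
move=> mf _ A mA; rewrite setTI.
suff : g_sigma_preimage coord `<=` [set B | measurable (f @^-1` B)] by exact.
apply: smallest_sub.
  split => /=.
  - by rewrite preimage_set0.
  - by move=> B mB; rewrite setTD preimage_setC; exact: measurableC.
  - by move=> F mF; rewrite preimage_bigcup; exact: bigcup_measurable.
rewrite -bigcup_seq; apply: bigcup_sub => i _ _ [B mB <-] /=.
rewrite setTI; have := mf i measurableT B mB.
by rewrite setTI.
Qed.

End measurable_rV.

Section lebesgue_rV.
Context (R : realType).

Definition consrV n (p : measurableTypeR R * 'rV[R]_n) : 'rV[R]_n.+1 :=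
  row_mx p.1%:M p.2 : 'rV[R]_(1 + n).

Definition unconsrV n (x : 'rV[R]_n.+1) : measurableTypeR R * 'rV[R]_n :=
  (x ord0 ord0, \row_i x ord0 (lift ord0 i)).

Lemma consrV0 n p : @consrV n p ord0 ord0 = p.1.
Proof.
transitivity ((p.1%:M : 'M[R]_1) ord0 ord0); last by rewrite mxE mulr1n.
rewrite -(row_mxEl (p.1%:M : 'M[R]_1) p.2 ord0 ord0) /consrV.
by congr (fun_of_matrix (row_mx _ _)); exact: val_inj.
Qed.

Lemma consrVS n p (i : 'I_n) : @consrV n p ord0 (lift ord0 i) = p.2 ord0 i.
Proof.
rewrite -(row_mxEr (p.1%:M : 'M[R]_1) p.2 ord0 i) /consrV.
by congr (fun_of_matrix (row_mx _ _)); exact: val_inj.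
Qed.

Lemma consrVK n : cancel (@consrV n) (@unconsrV n).
Proof.
move=> p; rewrite [RHS]surjective_pairing /unconsrV consrV0; congr pair.
by apply/rowP => i; rewrite mxE consrVS.
Qed.

Lemma unconsrVK n : cancel (@unconsrV n) (@consrV n).
Proof.
move=> x; apply/rowP => i.
by case: (unliftP ord0 i) => [j|] ->; rewrite ?consrV0 ?consrVS//= mxE.
Qed.

Lemma measurable_consrV n : measurable_fun setT (@consrV n).
Proof.
apply: measurable_fun_rV => i.
case: (unliftP ord0 i) => [j|] ->.
  under eq_fun do rewrite consrVS.
  exact: (measurableT_comp (@measurable_coord R n j) measurable_snd).
under eq_fun do rewrite consrV0.
exact: measurable_fst.
Qed.

Lemma measurable_unconsrV n : measurable_fun setT (@unconsrV n).
Proof.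
apply/measurable_fun_pairP; split; first exact: measurable_coord.
apply: measurable_fun_rV => i.
under eq_fun do rewrite /= mxE.
exact: measurable_coord.
Qed.

End lebesgue_rV.

Section lebesgue_rV_step.
Context (R : realType) (n : nat).
Variable nu : {sigma_finite_measure set 'rV[R]_n -> \bar R}.
Local Open Scope ereal_scope.

Definition lebesgue_rV_step : set 'rV[R]_n.+1 -> \bar R :=
  pushforward (@lebesgue_measure R \x nu) (@consrV R n).

Let mpre A : measurable A -> measurable (@consrV R n @^-1` A).
Proof. by move=> mA; rewrite -[X in measurable X]setTI; exact: measurable_consrV. Qed.

Let step0 : lebesgue_rV_step set0 = 0.
Proof. by rewrite /lebesgue_rV_step /pushforward preimage_set0 measure0. Qed.

Let step_ge0 A : 0 <= lebesgue_rV_step A.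
Proof. by rewrite /lebesgue_rV_step /pushforward; exact: measure_ge0. Qed.

Let step_sigma_additive : semi_sigma_additive lebesgue_rV_step.
Proof.
move=> F mF tF mUF; rewrite /lebesgue_rV_step /pushforward preimage_bigcup.
apply: measure_semi_sigma_additive.
- by move=> k; exact: mpre.
- apply/trivIsetP => /= i j _ _ ij; rewrite -preimage_setI.
  by move/trivIsetP : tF => /(_ _ _ _ _ ij) ->//; rewrite preimage_set0.
- by rewrite -preimage_bigcup; exact: mpre.
Qed.

HB.instance Definition _ := isMeasure.Build _ _ _
  lebesgue_rV_step step0 step_ge0 step_sigma_additive.

Let step_sigma_finite : sigma_finite setT lebesgue_rV_step.
Proof.
have /sigma_finiteP[F [TF ndF Foo]] := sigma_finiteT (@lebesgue_measure R).
have /sigma_finiteP[G [TG ndG Goo]] := sigma_finiteT nu.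
exists (fun k => @unconsrV R n @^-1` (F k `*` G k)).
  apply/esym; rewrite -subTset => x _.
  have : setT (unconsrV x).1 by [].
  rewrite TF => -[i _ Fi].
  have : setT (unconsrV x).2 by [].
  rewrite TG => -[j _ Gj].
  exists (maxn i j) => //; split.
    by move: Fi; exact/subsetPset/ndF/leq_maxl.
  by move: Gj; exact/subsetPset/ndG/leq_maxr.
move=> k; have [mF Fk] := Foo k; have [mG Gk] := Goo k; split.
  rewrite -[X in measurable X]setTI; apply: measurable_unconsrV => //.
  exact: measurableX.
rewrite /lebesgue_rV_step /pushforward.
rewrite (_ : _ @^-1` _ = F k `*` G k); last first.
  by apply/seteqP; split => x; rewrite /preimage /mkset consrVK.
by rewrite product_measure1E// lte_mul_pinfty// ge0_fin_numE.
Qed.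

HB.instance Definition _ := Measure_isSigmaFinite.Build _ _ _
  lebesgue_rV_step step_sigma_finite.

End lebesgue_rV_step.

Section lebesgue_rV0.
Context (R : realType).

Definition lebesgue_rV0 : set 'rV[R]_0 -> \bar R := \d_(0 : 'rV[R]_0).

HB.instance Definition _ := Measure.on lebesgue_rV0.

Let lebesgue_rV0_sigma_finite : sigma_finite setT lebesgue_rV0.
Proof.
apply: fin_num_fun_sigma_finite; first by rewrite measure0.
by move=> A mA; rewrite /lebesgue_rV0 diracE.
Qed.

HB.instance Definition _ := Measure_isSigmaFinite.Build _ _ _
  lebesgue_rV0 lebesgue_rV0_sigma_finite.

End lebesgue_rV0.

(* The (k+1)-dimensional Lebesgue measure is the image of the product of the
   one-dimensional one with the k-dimensional one under [consrV]. *)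
Fixpoint lebesgue_rV (R : realType) (n : nat) :
    {sigma_finite_measure set 'rV[R]_n -> \bar R} :=
  match n return {sigma_finite_measure set 'rV[R]_n -> \bar R} with
  | 0 => @lebesgue_rV0 R
  | k.+1 => lebesgue_rV_step (lebesgue_rV R k)
  end.

Lemma lebesgue_rV_box (R : realType) n (A : 'I_n -> set (measurableTypeR R)) : (forall i, measurable (A i)) ->
  measurable [set x : 'rV[R]_n | forall i, A i (x ord0 i)] /\
  lebesgue_rV R n [set x : 'rV[R]_n | forall i, A i (x ord0 i)] = (\prod_i lebesgue_measure (A i))%E.
Proof.
elim: n A => [|n IH] A mA.
  split.
    rewrite (_ : [set _ | _] = setT)//; apply/seteqP; split => // x _ [].
    by [].
  by rewrite big_ord0 /= /lebesgue_rV0 diracE mem_set// => -[].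
have [m1 m2] := IH (fun i => A (lift ord0 i)) (fun i => mA _).
have e : [set x : 'rV[R]_n.+1 | forall i, A i (x ord0 i)] = @unconsrV R n @^-1` (A ord0 `*` [set x : 'rV[R]_n | forall i, A (lift ord0 i) (x ord0 i)]).
  apply/seteqP; split => x /=.
    by move=> h; split; [exact: h|move=> i; rewrite mxE; exact: h].
  move=> [h0 h] i; case: (unliftP ord0 i) => [j|] -> //.
  by have := h j; rewrite mxE.
split.
  rewrite e -[X in measurable X]setTI; apply: measurable_unconsrV => //; exact: measurableX.
rewrite big_ord_recl -m2 /= /lebesgue_rV_step /pushforward e.
rewrite (_ : _ @^-1` _ = A ord0 `*` [set x : 'rV[R]_n | forall i, A (lift ord0 i) (x ord0 i)]).
  by rewrite product_measure1E.
by apply/seteqP; split => x; rewrite /preimage /mkset consrVK.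
Qed.

Section euclidean.
Context (R : realType) (d : nat).
Implicit Types (x y : 'rV[R]_d) (r : R).

Definition dotrV x y : R := \sum_(i < d) x ord0 i * y ord0 i.

(* Not `|x|, which is the sup norm on 'rV[R]_d. *)
Definition enorm x : R := Num.sqrt (dotrV x x).

Definition eball r : set 'rV[R]_d := [set x | enorm x < r].

End euclidean.

Section L2.
Context (R : realType) (d : nat).
Local Notation E := 'rV[R]_d.
Local Notation mu := (lebesgue_rV R d).
Implicit Types (f g u w U F : E -> R[i]).

Definition RtoC (f : E -> R) : E -> R[i] := fun x => (f x)%:C.

Definition L2 f : Prop :=
  (fun x => complex.Re (f x)) \in Lfun mu 2%:E /\
  (fun x => complex.Im (f x)) \in Lfun mu 2%:E.

Definition L2norm f : \bar R :=
  Lnorm mu 2%:E (fun x => (ComplexField.Normc.normc (f x))%:E).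

Definition L2cvg (fk : nat -> E -> R[i]) f : Prop :=
  L2norm (fun x => fk k x - f x) @[k --> \oo] --> 0%E.

Definition Cintegral f : R[i] :=
  (\int[mu]_x complex.Re (f x)) +i* (\int[mu]_x complex.Im (f x)).

Definition expi (t : R) : R[i] := cos t +i* sin t.

Definition fourierL1 f (xi : E) : R[i] :=
  ((Num.sqrt (2 * pi)) ^- d)%:C *
    Cintegral (fun x => expi (- dotrV x xi) * f x).

Definition inv_fourierL1 F (x : E) : R[i] :=
  ((Num.sqrt (2 * pi)) ^- d)%:C *
    Cintegral (fun xi => expi (dotrV x xi) * F xi).

Definition truncate (n : nat) f : E -> R[i] :=
  fun x => (\1_(eball n%:R) x)%:C * f x.

(* Plancherel transform: [F] is the L^2 limit of the Fourier transforms of the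
   truncations of [f], which lie in both L^1 and L^2. *)
Definition fourierL2 f F : Prop :=
  [/\ L2 f, L2 F & L2cvg (fun n => fourierL1 (truncate n f)) F].

Definition inv_fourierL2 F f : Prop :=
  [/\ L2 F, L2 f & L2cvg (fun n => inv_fourierL1 (truncate n F)) f].

Section multiplier.
Variable s : E -> R.

Definition multiplier_graph u w : Prop :=
  exists2 U, fourierL2 u U & inv_fourierL2 (fun xi => (s xi)%:C * U xi) w.

Definition multiplier_dom u : Prop := exists w, multiplier_graph u w.

(* A representative of the value (unique up to null sets); only meaningful on
   [multiplier_dom]. *)
Definition multiplier u : E -> R[i] :=
  xget (fun=> 0) [set w | multiplier_graph u w].

End multiplier.

End L2.

(* An unbounded operator on L^2 is given by its graph. *)
Section spectrum.
Context (R : realType) (d : nat).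
Local Notation E := 'rV[R]_d.
Local Notation mu := (lebesgue_rV R d).
Variable A : (E -> R[i]) -> (E -> R[i]) -> Prop.
Implicit Types (u w f : E -> R[i]) (z : R[i]).

(* [A - z] is onto, and injective with bounded inverse. *)
Definition resolvent_set : set R[i] :=
  [set z | (forall f, L2 f -> exists u, A u (fun x => f x + z * u x)) /\
           exists M : R, forall u w, A u w ->
             (L2norm u <= M%:E * L2norm (fun x => w x - z * u x)%R)%E].

Definition spectrum : set R[i] := ~` resolvent_set.

Definition L2_eigenspace z : set (E -> R[i]) :=
  [set u | A u (fun x => z * u x)].

Definition L2_eigenvalue z : Prop :=
  exists2 u, L2_eigenspace z u & ~ (u = (fun=> 0) %[ae mu]).

Definition finite_multiplicity z : Prop :=
  exists (n : nat) (e : 'I_n -> E -> R[i]), forall u, L2_eigenspace z u ->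
    exists c : 'I_n -> R[i],
      u = (fun x => \sum_(i < n) c i * e i x) %[ae mu].

Definition discrete_spectrum : set R[i] :=
  [set z | [/\ isolated (spectrum : set (R[i] : numFieldType)) z,
               L2_eigenvalue z & finite_multiplicity z]].

(* On R[i], [x <= y] means that y - x is a nonnegative real. *)
Definition ground_state (lam : R) (phi : E -> R) : Prop :=
  [/\ discrete_spectrum lam%:C,
      (forall z, discrete_spectrum z -> lam%:C <= z) &
      [/\ L2_eigenspace lam%:C (RtoC phi), continuous phi,
          (forall x, 0 < phi x) & L2norm (RtoC phi) = 1%E]].

End spectrum.

Section hamiltonians.
Context (R : realType) (d : nat).
Local Notation E := 'rV[R]_d.
Local Notation mu := (lebesgue_rV R d).
Variables (m alpha : R).

Definition Phi (z : R) : R :=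
  (z + m `^ (2 / alpha)) `^ (alpha / 2) - m.

Definition PhiLaplacian_dom : (E -> R[i]) -> Prop :=
  multiplier_dom (fun xi => Phi (enorm xi ^+ 2)).

Definition PhiLaplacian : (E -> R[i]) -> E -> R[i] :=
  multiplier (fun xi => Phi (enorm xi ^+ 2)).

Definition hamiltonian (V : E -> R) (u w : E -> R[i]) : Prop :=
  [/\ PhiLaplacian_dom u, L2 w &
      w = (fun x => PhiLaplacian u x + (V x)%:C * u x) %[ae mu]].

Definition bump (x : E) : R :=
  if enorm x < 1 then expR (- (1 - enorm x ^+ 2)^-1) else 0.

Definition mollifier (x : E) : R := (\int[mu]_y bump y)^-1 * bump x.

Definition scaled_mollifier (h : R) (x : E) : R :=
  h ^- d * mollifier (h^-1 *: x).

Variables (v a : R).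

Definition cutoff (eps : R) (x : E) : R :=
  \int[mu]_y (scaled_mollifier (eps / 2) (x - y) * \1_(eball (a + eps / 2)) y).

Definition well (x : E) : R := - v * \1_(eball a) x.

Definition smooth_well (eps : R) (x : E) : R := - v * cutoff eps x.

End hamiltonians.

(* Main.v *)
Require Import Defs.
From HB Require Import structures.
From mathcomp Require Import all_boot all_order all_algebra.
From mathcomp Require Import all_classical all_reals all_analysis.
From mathcomp Require Import measurable_realfun.
From mathcomp Require Import complex.
From mathcomp Require Import ring lra.
Import Order.TTheory GRing.Theory Num.Theory.
Import numFieldNormedType.Exports.
Local Open Scope classical_set_scope.
Local Open Scope ring_scope.

(** The eigenvalue equations turn the non-local operator into multiplication
    by a bounded function: almost everywhere

      Phi(-Delta) phi   = (lam + v 1_(B_a)) phi      =: Q phi,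
      Phi(-Delta) phi_k = (lam_k + v eta_(eps_k)) phi_k =: Q_k phi_k

    ([eigenfunction_PhiLaplacian]). Membership in the domain and in L^2 is part
    of what it means to be an eigenfunction. It remains to show that Q_k phi_k
    tends to Q phi in L^2, which follows from the splitting

      Q_k phi_k - Q phi = Q_k (phi_k - phi) + (Q_k - Q) phi.

    The multipliers Q_k are bounded uniformly in k, because lam_k converges and
    0 <= eta <= 1, so the first term is controlled by the L^2 convergence of
    phi_k. The second term tends to 0 by dominated convergence as soon as Q_k
    tends to Q almost everywhere ([cvg_bounded_mul_L2]).

    The work therefore lies in the cutoffs. The function eta_eps is an average
    of the indicator of B_(a + eps/2) against a probability density supported
    in the ball of radius eps/2; so it lies between 0 and 1, equals 1 on the
    closed ball of radius a and vanishes outside B_(a + eps). Hence it tends to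
    the indicator of B_a off the sphere of radius a ([cvg_cutoff]), and the
    sphere is a null set ([sphere_null]). That the rescaled, reflected and
    translated mollifier still has mass 1 is the affine change of variables for
    Lebesgue measure on R^d ([ge0_integral_affine_rV]), obtained from the
    one-dimensional one by induction on d along the product structure of the
    measure. *)

Set Implicit Arguments.
Unset Strict Implicit.
Unset Printing Implicit Defensive.

(** * Affine changes of variables for Lebesgue measure *)

Section affine1.
Context {R : realType}.
Local Notation mu := (@lebesgue_measure R).
Local Notation M := (measurableTypeR R).

Definition affine (c p : R) (t : M) : M := c * t + p.

Lemma measurable_affine (c p : R) : measurable_fun setT (affine c p).
Proof. by apply: measurable_funD => //; exact: measurable_funM. Qed.

(** Both sides are measures in [A], so they agree as soon as they agree on
    half-open intervals; for [c < 0] the preimage of such an interval is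
    half-open on the other side. *)
Lemma lebesgue_measure_affine (c p : R) (A : set M) : c != 0 -> measurable A ->
  (`|c|%:E * mu (affine c p @^-1` A) = mu A)%E.
Proof.
move=> c0 mA.
pose push : {measure set M -> \bar R} := pushforward mu (affine c p).
pose nu : {measure set M -> \bar R} :=
  mscale (NngNum (normr_ge0 c)) (push (@measurable_affine c p)).
suff /(_ A mA) -> : forall B, measurable B -> mu B = nu B by [].
apply: lebesgue_measure_unique => _ [[x y]] _ <-.
rewrite -[RHS]/(`|c|%:E * mu (affine c p @^-1` `]x, y]%classic))%E.
have [c_gt0|c_le0] := ltP 0 c.
  have -> : affine c p @^-1` `]x, y] = `](x - p) / c, (y - p) / c]%classic.
    apply/seteqP; split => t /=; rewrite !in_itv /= /affine;
      by rewrite ltr_pdivrMr// ler_pdivlMr// ltrBlDr lerBrDr (mulrC t).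
  rewrite !lebesgue_measure_itv /= !lte_fin ltr_pM2r ?invr_gt0// ltrD2r.
  case: ifP => xy; last by rewrite mule0.
  rewrite gtr0_norm// -!EFinB -EFinM; congr EFin.
  by field.
have {c_le0} c_lt0 : c < 0 by rewrite lt_neqAle c0.
have -> : affine c p @^-1` `]x, y] = `[(y - p) / c, (x - p) / c[%classic.
  apply/seteqP; split => t /=; rewrite !in_itv /= /affine;
    by rewrite ltr_ndivlMr// ler_ndivrMr// ltrBlDr lerBrDr (mulrC t) andbC.
rewrite !lebesgue_measure_itv /= !lte_fin ltr_nM2r ?invr_lt0// ltrD2r.
case: ifP => xy; last by rewrite mule0.
rewrite ltr0_norm// -!EFinB -EFinM; congr EFin.
by field.
Qed.

Lemma ge0_integral_affine (c p : R) (f : M -> \bar R) : c != 0 ->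
  measurable_fun setT f -> (forall t, 0 <= f t)%E ->
  (\int[mu]_t f (affine c p t) = `|c|^-1%:E * \int[mu]_t f t)%E.
Proof.
move=> c0 mf f0.
have c_gt0 : 0 < `|c| by rewrite normr_gt0.
pose push : {measure set M -> \bar R} := pushforward mu (affine c p).
have -> : (\int[mu]_t f t = \int[mscale (NngNum (normr_ge0 c))
    (push (@measurable_affine c p))]_t f t)%E.
  apply: eq_measure_integral => A mA _; rewrite /mscale /=.
  by rewrite /pushforward -(lebesgue_measure_affine p c0 mA).
rewrite ge0_integral_mscale// ge0_integral_pushforward//=.
rewrite muleA -EFinM mulVf ?gt_eqF// mul1e preimage_setT//.
exact: measurable_affine.
Qed.

End affine1.

Section rV.
Context {R : realType}.
Local Notation M := (measurableTypeR R).

(** Tonelli's theorem for the first coordinate against the others, in both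
    orders of integration. *)
Lemma ge0_integral_rVS n (f : 'rV[R]_n.+1 -> \bar R) :
  measurable_fun setT f -> (forall x, 0 <= f x)%E ->
  (\int[lebesgue_rV R n.+1]_x f x =
   \int[@lebesgue_measure R]_t \int[lebesgue_rV R n]_y f (consrV (t, y)))%E.
Proof.
move=> mf f0; rewrite [LHS]ge0_integral_pushforward//; last first.
  exact: measurable_consrV.
rewrite preimage_setT fubini_tonelli1//.
  exact: measurableT_comp mf (@measurable_consrV R n).
by move=> x; exact: f0.
Qed.

Lemma ge0_integral_rVS_swap n (f : 'rV[R]_n.+1 -> \bar R) :
  measurable_fun setT f -> (forall x, 0 <= f x)%E ->
  (\int[lebesgue_rV R n.+1]_x f x =
   \int[lebesgue_rV R n]_y \int[@lebesgue_measure R]_t f (consrV (t, y)))%E.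
Proof.
move=> mf f0; rewrite [LHS]ge0_integral_pushforward//; last first.
  exact: measurable_consrV.
rewrite preimage_setT fubini_tonelli2//.
  exact: measurableT_comp mf (@measurable_consrV R n).
by move=> x; exact: f0.
Qed.

Lemma measurable_affine_rV n (c : R) (p : 'rV[R]_n) :
  measurable_fun setT (fun x : 'rV[R]_n => c *: x + p).
Proof.
apply: measurable_fun_rV => i; under eq_fun do rewrite !mxE.
apply: measurable_funD => //.
apply: measurable_funM => //; exact: measurable_coord.
Qed.

Lemma affine_consrV n (c : R) (p : 'rV[R]_n.+1) t y :
  c *: consrV (t, y) + p =
  consrV (affine c (unconsrV p).1 t, c *: y + (unconsrV p).2).
Proof.
apply/rowP => i.
rewrite mxE [X in X + _]mxE.
by case: (unliftP ord0 i) => [j|] ->; rewrite ?consrVS ?consrV0//= !mxE.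
Qed.

(** Each coordinate is transformed separately, so the one-dimensional rule
    applies once per coordinate, each time with the factor [`|c|^-1]. *)
Lemma ge0_integral_affine_rV n (c : R) (p : 'rV[R]_n) (f : 'rV[R]_n -> \bar R) :
  c != 0 -> measurable_fun setT f -> (forall x, 0 <= f x)%E ->
  (\int[lebesgue_rV R n]_x f (c *: x + p)%R =
   (`|c|^-n)%:E * \int[lebesgue_rV R n]_x f x)%E.
Proof.
move=> c0; elim: n p f => [|n IH] p f mf f0.
  rewrite expr0 invr1 mul1e; apply: eq_integral => x _.
  by congr f; apply/rowP => -[].
have mfc : measurable_fun setT (f \o @consrV R n).
  exact: measurableT_comp mf (@measurable_consrV R n).
have mF : measurable_fun setT
    (fun t : M => \int[lebesgue_rV R n]_y f (consrV (t, y)))%E.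
  apply: (measurable_fun_fubini_tonelli_F (f \o @consrV R n)) => //.
  by move=> x; exact: f0.
rewrite ge0_integral_rVS; last 2 first.
- exact: measurableT_comp mf (@measurable_affine_rV _ _ _).
- by move=> x; exact: f0.
rewrite [in RHS]ge0_integral_rVS//.
under eq_integral do under eq_integral do rewrite affine_consrV.
transitivity (\int[@lebesgue_measure R]_t ((`|c|^-n)%:E *
    \int[lebesgue_rV R n]_y f (consrV (affine c (unconsrV p).1 t, y))))%E.
  apply: eq_integral => t _.
  rewrite (IH _ (fun y => f (consrV (_, y))))//.
  exact: measurableT_comp mfc (@measurable_pair1 _ _ _ _ _).
pose F := fun t : M => (\int[lebesgue_rV R n]_y f (consrV (t, y)))%E.
have F0 t : (0 <= F t)%E by apply: integral_ge0 => y _; exact: f0.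
rewrite (@ge0_integralZl _ _ _ _ _ _ (F \o affine c (unconsrV p).1)).
- by rewrite (ge0_integral_affine _ c0 mF F0) muleA -EFinM -invfM -exprSr.
- exact: measurableT.
- exact: measurableT_comp mF (@measurable_affine _ _ _).
- by move=> t _; exact: F0.
- by rewrite lee_fin invr_ge0 exprn_ge0.
Qed.

End rV.

(** * Euclidean norm, balls and spheres *)

Section enorm.
Context {R : realType} {d : nat}.
Implicit Types (x y : 'rV[R]_d) (c r : R).

Lemma dotrV_ge0 x : 0 <= dotrV x x.
Proof. by apply: sumr_ge0 => i _; rewrite -expr2 sqr_ge0. Qed.

Lemma enorm_ge0 x : 0 <= enorm x.
Proof. exact: sqrtr_ge0. Qed.

Lemma sqr_enorm x : enorm x ^+ 2 = dotrV x x.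
Proof. exact/sqr_sqrtr/dotrV_ge0. Qed.

Lemma enormZ c x : enorm (c *: x) = `|c| * enorm x.
Proof.
rewrite /enorm -sqrtr_sqr -sqrtrM ?sqr_ge0//; congr Num.sqrt.
by rewrite /dotrV mulr_sumr; apply: eq_bigr => i _; rewrite !mxE; ring.
Qed.

Lemma dotrV_shiftE x y c :
  dotrV (c *: x + y) (c *: x + y) =
  c ^+ 2 * dotrV x x + (c * dotrV x y) *+ 2 + dotrV y y.
Proof.
rewrite /dotrV !mulr_sumr -sumrMnl -!big_split; apply: eq_bigr => i _ /=.
by rewrite !mxE; ring.
Qed.

Lemma coord_le_enorm x i : `|x ord0 i| <= enorm x.
Proof.
rewrite -(@ler_pXn2r _ 2)// ?nnegrE ?enorm_ge0// sqr_enorm /dotrV.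
rewrite real_normK ?num_real// (bigD1 i)//= expr2 lerDl.
by apply: sumr_ge0 => j _; rewrite -expr2 sqr_ge0.
Qed.

Lemma enorm_eq0 x : enorm x = 0 -> x = 0.
Proof.
move=> x0; apply/rowP => i; rewrite mxE; apply/normr0_eq0/le_anti.
by rewrite normr_ge0 andbT -x0 coord_le_enorm.
Qed.

Lemma cauchy_schwarz_dotrV x y : dotrV x y <= enorm x * enorm y.
Proof.
have [/enorm_eq0 ->|x0] := eqVneq (enorm x) 0.
  by rewrite /dotrV big1 ?mulr_ge0 ?enorm_ge0// => i _; rewrite mxE mul0r.
have [/enorm_eq0 ->|y0] := eqVneq (enorm y) 0.
  by rewrite /dotrV big1 ?mulr_ge0 ?enorm_ge0// => i _; rewrite mxE mulr0.
have x_gt0 : 0 < enorm x by rewrite lt_neqAle eq_sym x0 enorm_ge0.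
have y_gt0 : 0 < enorm y by rewrite lt_neqAle eq_sym y0 enorm_ge0.
(* The form [dotrV (c *: x + y) (c *: x + y)] is minimal at
   [c = - dotrV x y / enorm x ^+ 2]; the value of [c] taken here is that
   minimizer in the equality case, and it makes the form factor. *)
have := dotrV_ge0 (- (enorm y / enorm x) *: x + y).
rewrite dotrV_shiftE -!sqr_enorm.
have -> : (- (enorm y / enorm x)) ^+ 2 * enorm x ^+ 2 +
    (- (enorm y / enorm x) * dotrV x y) *+ 2 + enorm y ^+ 2 =
    (2 * enorm y / enorm x) * (enorm x * enorm y - dotrV x y).
  by field.
by rewrite pmulr_rge0 ?subr_ge0// divr_gt0// mulr_gt0.
Qed.

Lemma enorm_triangle x y : enorm (x + y) <= enorm x + enorm y.
Proof.
rewrite -(@ler_pXn2r _ 2)// ?nnegrE ?addr_ge0 ?enorm_ge0//.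
rewrite sqrrD !sqr_enorm -{1}[x]scale1r -{2}[x]scale1r dotrV_shiftE.
rewrite expr1n !mul1r lerD2r lerD2l lerMn2r/=.
exact: cauchy_schwarz_dotrV.
Qed.

Lemma measurable_enorm : measurable_fun setT (@enorm R d).
Proof.
apply: (@measurableT_comp _ _ _ _ _ _ (@Num.sqrt R)).
  by apply: continuous_measurable_fun; exact: sqrt_continuous.
by apply: measurable_sum => i; apply: measurable_funM; exact: measurable_coord.
Qed.

Lemma measurable_eball r : measurable (@eball R d r).
Proof.
have -> : @eball R d r = @enorm R d @^-1` `]-oo, r[.
  by apply/seteqP; split => x /=; rewrite in_itv.
by rewrite -[X in measurable X]setTI; exact: measurable_enorm.
Qed.

Lemma measurable_sphere r : measurable [set x : 'rV[R]_d | enorm x = r].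
Proof.
rewrite -[X in measurable X]setTI.
exact: measurable_enorm measurableT _ (measurable_set1 r).
Qed.

Lemma eball_subset_box r : @eball R d r `<=`
  [set x | forall i, `[- r, r]%classic (x ord0 i)].
Proof.
move=> x xr i /=; rewrite in_itv /= -ler_norml.
exact/ltW/(le_lt_trans (coord_le_enorm x i)).
Qed.

End enorm.

Lemma dotrV_consrV (R : realType) n (t : R) (y : 'rV[R]_n) :
  dotrV (consrV (t, y)) (consrV (t, y)) = t ^+ 2 + dotrV y y.
Proof.
rewrite /dotrV big_ord_recl consrV0 expr2; congr (_ + _).
by apply: eq_bigr => i _; rewrite consrVS.
Qed.

(** Every line parallel to the first axis meets the sphere in at most two
    points, so all its one-dimensional sections are null. There is no such axis
    in dimension 0, where the sphere of radius 0 has mass 1. *)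
Lemma sphere_null (R : realType) n (r : R) :
  (0 < n)%N -> lebesgue_rV R n [set x | enorm x = r] = 0%E.
Proof.
case: n => // n _; set S := [set x | _].
have mS : measurable S by exact: measurable_sphere.
rewrite -[S]setIT -integral_indic// ge0_integral_rVS_swap; last 2 first.
- exact/measurable_EFinP/measurable_indicP.
- by move=> x; rewrite lee_fin.
apply: integral0_eq => y _.
have msec : measurable ((fun t : measurableTypeR R => consrV (t, y)) @^-1` S).
  rewrite -[X in measurable X]setTI.
  apply: (@measurableT_comp _ _ _ _ _ _ (@consrV R n)) => //.
  exact: measurable_consrV.
rewrite [LHS](_ : _ =
    lebesgue_measure ((fun t : measurableTypeR R => consrV (t, y)) @^-1` S));
  last first.
  by rewrite -[X in lebesgue_measure X]setIT -integral_indic.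
pose s := Num.sqrt (r ^+ 2 - dotrV y y).
apply/countable_lebesgue_measure0/finite_set_countable.
apply: (@sub_finite_set _ _ [set s; - s]); last exact: finite_set2.
move=> t /= tr; have : t ^+ 2 = r ^+ 2 - dotrV y y.
  by rewrite -tr sqr_enorm dotrV_consrV addrK.
move=> /(congr1 Num.sqrt); rewrite sqrtr_sqr -/s => <-.
by case: (ger0P t) => _; [left|right; rewrite opprK].
Qed.

(** * The bump function *)

Local Notation bump := (@Defs.bump _ _).

Section bump.
Context {R : realType} {d : nat}.
Local Notation mu := (lebesgue_rV R d).
Implicit Types (x : 'rV[R]_d).

Lemma bump_ge0 x : 0 <= bump x.
Proof. by rewrite /bump; case: ifP => // _; exact: expR_ge0. Qed.

Lemma bump_eq0 x : 1 <= enorm x -> bump x = 0.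
Proof. by rewrite /bump leNgt; case: ifP. Qed.

Lemma bump_gt0 x : eball 1 x -> 0 < bump x.
Proof. by rewrite /eball /bump /= => ->; exact: expR_gt0. Qed.

Lemma bump_le_indic x : bump x <= \1_(eball 1) x.
Proof.
have [x1|x1] := ltP (enorm x) 1; last by rewrite bump_eq0.
rewrite indicE mem_set// /bump x1 -[leRHS]expR0 ler_expR oppr_le0 invr_ge0.
by rewrite subr_ge0 expr_le1 ?enorm_ge0// ltW.
Qed.

Lemma measurable_bump : measurable_fun setT (@Defs.bump R d).
Proof.
(* The argument of the inverse is positive inside the ball, where inversion is
   the real power of exponent -1, a measurable function. *)
have -> : @Defs.bump R d = fun x =>
    if enorm x < 1 then expR (- ((1 - enorm x ^+ 2) `^ (-1))) else 0.
  apply/funext => x; rewrite /bump; case: ifPn => // x1.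
  by rewrite powR_inv1// subr_ge0 expr_le1 ?enorm_ge0// ltW.
apply: measurable_fun_ifT => //.
  by apply: measurable_fun_ltr => //; exact: measurable_enorm.
apply: measurableT_comp => //; apply: measurableT_comp => //.
apply: (@measurableT_comp _ _ _ _ _ _ (@powR R ^~ (-1))).
  exact: measurable_powR.
apply: measurable_funB => //; apply: measurable_funX.
exact: measurable_enorm.
Qed.

(** The ball is contained in a cube. *)
Lemma lebesgue_eball_lty (r : R) : (mu (eball r) < +oo)%E.
Proof.
have [mB muB] := @lebesgue_rV_box R d (fun=> `[- r, r]%classic)
  (fun=> measurable_itv _).
apply: (@le_lt_trans _ _ (mu [set x | forall i, `[- r, r]%classic (x ord0 i)])).
  apply: le_measure; rewrite ?inE//; first exact: measurable_eball.
  exact: eball_subset_box.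
rewrite ltey_eq muB; apply/orP; left.
elim/big_ind : _ => // [x y|i _]; first exact: fin_numM.
by rewrite lebesgue_measure_itv/=; case: ifP.
Qed.

(** The ball contains a cube; the half-side [r / d.+1%:R] leaves room for the
    inequality to be strict and for [d = 0]. *)
Lemma lebesgue_eball_gt0 (r : R) : 0 < r -> (0 < mu (eball r))%E.
Proof.
move=> r0; pose s := r / d.+1%:R.
have s0 : 0 < s by rewrite divr_gt0.
have [mB muB] := @lebesgue_rV_box R d (fun=> `[- s, s]%classic)
  (fun=> measurable_itv _).
apply: (@lt_le_trans _ _ (mu [set x | forall i, `[- s, s]%classic (x ord0 i)])).
  rewrite muB; elim/big_ind : _ => // [x y|i _]; first exact: mule_gt0.
  rewrite lebesgue_measure_itv/= lte_fin gtrN//.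
  by rewrite lte_fin opprK addr_gt0.
apply: le_measure; rewrite ?inE//; first exact: measurable_eball.
move=> x /= xs; rewrite /eball /=.
rewrite -(@ltr_pXn2r _ 2)// ?nnegrE ?enorm_ge0 ?(ltW r0)// sqr_enorm /dotrV.
have -> : r = s * d.+1%:R by rewrite divfK.
apply: (@le_lt_trans _ _ (\sum_(i < d) s ^+ 2)).
  apply: ler_sum => i _; have := xs i; rewrite in_itv/= -ler_norml => xis.
  by rewrite -expr2 -real_normK ?num_real// lerXn2r// nnegrE ltW.
rewrite sumr_const card_ord [ltRHS]exprMn -[ltLHS]mulr_natr ltr_pM2l ?exprn_gt0//.
by rewrite -natrX ltr_nat (leq_trans (ltnSn d))// expnS leq_pmulr.
Qed.

(** With [integral_bump_gt0], this makes the normalization of the mollifier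
    meaningful: the real-valued integral of [bump] is then neither the default
    value 0 of an infinite integral nor a genuine 0. *)
Lemma integral_bump_lty : (\int[mu]_x (bump x)%:E < +oo)%E.
Proof.
apply: (@le_lt_trans _ _ (mu (eball 1))); last exact: lebesgue_eball_lty.
rewrite -[X in mu X]setIT -integral_indic//; last exact: measurable_eball.
apply: ge0_le_integral => //.
- by move=> x _; rewrite lee_fin bump_ge0.
- by apply/measurable_EFinP; exact: measurable_bump.
- by apply/measurable_EFinP/measurable_indicP; exact: measurable_eball.
- by move=> x _; rewrite lee_fin bump_le_indic.
Qed.

Lemma integral_bump_gt0 : (0 < \int[mu]_x (bump x)%:E)%E.
Proof.
rewrite lt0e integral_ge0 ?andbT => [|x _]; last by rewrite lee_fin bump_ge0.
apply/eqP => bump_int0.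
have mb : measurable_fun setT (EFin \o @Defs.bump R d).
  by apply/measurable_EFinP; exact: measurable_bump.
have [bump_ae0 _] := @ae_eq_integral_abs _ _ _ mu _ measurableT _ mb.
have [|N [mN muN0 bumpN]] := bump_ae0.
  rewrite -[RHS]bump_int0; apply: eq_integral => x _.
  by rewrite /= ger0_norm ?bump_ge0.
have := @lebesgue_eball_gt0 1 ltr01; rewrite ltNge => /negP; apply.
rewrite -muN0; apply: le_measure; rewrite ?inE//; first exact: measurable_eball.
move=> x x1; apply: bumpN => /= /(_ I) [bx0].
by have := bump_gt0 x1; rewrite bx0 ltxx.
Qed.

End bump.

(** * Mollified indicators of balls *)

Section cutoff.
Context {R : realType} {d : nat}.
Local Notation mu := (lebesgue_rV R d).
Implicit Types (x y : 'rV[R]_d) (h a eps : R).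

Let bump_mass_gt0 : 0 < \int[mu]_x (bump x : R).
Proof. by rewrite /Rintegral fine_gt0// integral_bump_gt0 integral_bump_lty. Qed.

Lemma mollifier_ge0 x : 0 <= mollifier x.
Proof. by rewrite /mollifier mulr_ge0 ?bump_ge0// invr_ge0 ltW. Qed.

Lemma measurable_mollifier : measurable_fun setT (@mollifier R d).
Proof. by apply: measurable_funM => //; exact: measurable_bump. Qed.

Lemma integral_mollifier : (\int[mu]_x (mollifier x)%:E = 1)%E.
Proof.
under eq_integral do rewrite /mollifier EFinM.
rewrite ge0_integralZl//; last 3 first.
- by apply/measurable_EFinP; exact: measurable_bump.
- by move=> x _; rewrite lee_fin bump_ge0.
- by rewrite lee_fin invr_ge0 ltW.
rewrite -[X in (_ * X)%E]fineK; last first.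
  by rewrite ge0_fin_numE ?integral_bump_lty// ltW// integral_bump_gt0.
by rewrite -EFinM mulVf// gt_eqF.
Qed.

Lemma scaled_mollifier_ge0 h x : 0 < h -> 0 <= scaled_mollifier h x.
Proof.
move=> h0; rewrite /scaled_mollifier mulr_ge0 ?mollifier_ge0//.
by rewrite invr_ge0 exprn_ge0 ?ltW.
Qed.

Lemma scaled_mollifier_eq0 h x : 0 < h -> h <= enorm x ->
  scaled_mollifier h x = 0.
Proof.
move=> h0 hx; rewrite /scaled_mollifier /mollifier bump_eq0 ?mulr0//.
by rewrite enormZ gtr0_norm ?invr_gt0// ler_pdivlMl// mulr1.
Qed.

Lemma measurable_scaled_mollifier h :
  measurable_fun setT (@scaled_mollifier R d h).
Proof.
apply: measurable_funM => //.
apply: (@measurableT_comp _ _ _ _ _ _ (@mollifier R d)).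
  exact: measurable_mollifier.
have -> : *:%R h^-1 = (fun x : 'rV[R]_d => h^-1 *: x + 0).
  by apply/funext => x; rewrite addr0.
exact: measurable_affine_rV.
Qed.

(** As a function of [y], [scaled_mollifier h (x - y)] is the mollifier composed
    with the affine map of ratio [- h^-1], whose Jacobian [h^-1 ^+ d] the
    prefactor compensates. *)
Lemma integral_scaled_mollifier h x : 0 < h ->
  (\int[mu]_y (scaled_mollifier h (x - y))%:E = 1)%E.
Proof.
move=> h0.
rewrite (_ : (fun y => _) = (fun y =>
  (h ^- d)%:E * (mollifier (- h^-1 *: y + h^-1 *: x))%:E)%E); last first.
  apply/funext => y; rewrite /scaled_mollifier -EFinM scalerBr scaleNr.
  by rewrite addrC.
rewrite ge0_integralZl//; last 3 first.
- apply/measurable_EFinP.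
  exact: measurableT_comp measurable_mollifier (@measurable_affine_rV _ _ _ _).
- by move=> y _; rewrite lee_fin mollifier_ge0.
- by rewrite lee_fin invr_ge0 exprn_ge0 ?ltW.
rewrite (@ge0_integral_affine_rV _ _ _ _ (EFin \o @mollifier R d)).
- rewrite /= integral_mollifier mule1 -EFinM normrN gtr0_norm ?invr_gt0//.
  by rewrite exprVn invrK mulVf// expf_neq0 ?gt_eqF.
- by rewrite oppr_eq0 invr_eq0 gt_eqF.
- by apply/measurable_EFinP; exact: measurable_mollifier.
- by move=> y; rewrite lee_fin mollifier_ge0.
Qed.

(** The cutoff before its integral is turned into a real number: bounds are proved
    for this one, and show that it is finite. *)
Let ecutoff a eps x : \bar R :=
  (\int[mu]_y (scaled_mollifier (eps / 2) (x - y) *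
               \1_(eball (a + eps / 2)) y)%:E)%E.

Lemma measurable_subrV :
  measurable_fun setT (fun p : 'rV[R]_d * 'rV[R]_d => p.1 - p.2).
Proof.
apply: measurable_fun_rV => i; under eq_fun do rewrite !mxE.
by apply: measurable_funB;
  apply: (@measurableT_comp _ _ _ _ _ _ (fun x : 'rV[R]_d => x ord0 i)) => //;
  exact: measurable_coord.
Qed.

Let measurable_integrand a eps : measurable_fun setT
  (fun p : 'rV[R]_d * 'rV[R]_d => (scaled_mollifier (eps / 2) (p.1 - p.2) *
               \1_(eball (a + eps / 2)) p.2)%:E).
Proof.
apply/measurable_EFinP/measurable_funM.
  exact: measurableT_comp (measurable_scaled_mollifier _) measurable_subrV.
apply: measurableT_comp => //.
by apply/measurable_indicP; exact: measurable_eball.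
Qed.

Let integrand_ge0 a eps x y : 0 < eps ->
  0 <= scaled_mollifier (eps / 2) (x - y) * \1_(eball (a + eps / 2)) y.
Proof. by move=> e0; rewrite mulr_ge0// scaled_mollifier_ge0// divr_gt0. Qed.

Let ecutoff_ge0 a eps x : 0 < eps -> (0 <= ecutoff a eps x)%E.
Proof.
by move=> e0; apply: integral_ge0 => y _; rewrite lee_fin integrand_ge0.
Qed.

Let ecutoff_le1 a eps x : 0 < eps -> (ecutoff a eps x <= 1)%E.
Proof.
move=> e0; have e20 : 0 < eps / 2 by rewrite divr_gt0.
rewrite -(integral_scaled_mollifier x e20); apply: ge0_le_integral => //.
- by move=> y _; rewrite lee_fin integrand_ge0.
- exact: measurableT_comp (measurable_integrand a eps) (@measurable_pair1 _ _ _ _ x).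
- apply/measurable_EFinP; apply: measurableT_comp.
    exact: measurable_scaled_mollifier.
  exact: measurableT_comp measurable_subrV (@measurable_pair1 _ _ _ _ x).
- by move=> y _; rewrite lee_fin ler_piMr ?scaled_mollifier_ge0.
Qed.

Lemma cutoff_ge0 a eps x : 0 < eps -> 0 <= cutoff a eps x.
Proof. by move=> e0; rewrite /cutoff /Rintegral fine_ge0// ecutoff_ge0. Qed.

Lemma cutoff_le1 a eps x : 0 < eps -> cutoff a eps x <= 1.
Proof.
move=> e0; rewrite -lee_fin /cutoff /Rintegral fineK ?ecutoff_le1//.
rewrite ge0_fin_numE ?ecutoff_ge0//.
by apply: (le_lt_trans (ecutoff_le1 _ _ e0)); rewrite ltry.
Qed.

(** The cutoff is a partial integral of a jointly measurable function. *)
Lemma measurable_cutoff a eps : 0 < eps ->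
  measurable_fun setT (@cutoff R d a eps).
Proof.
move=> e0; apply: (@measurableT_comp _ _ _ _ _ _ (@fine R)) => //.
apply: (measurable_fun_fubini_tonelli_F
  (fun p : 'rV[R]_d * 'rV[R]_d => (scaled_mollifier (eps / 2) (p.1 - p.2) *
               \1_(eball (a + eps / 2)) p.2)%:E)) => //.
by move=> p; rewrite lee_fin integrand_ge0.
Qed.

(** The mollifier centred at [x] charges only points at distance less than
    [eps / 2] from [x], all of which lie in the ball being averaged. *)
Lemma cutoff_eq1 a eps x : 0 < eps -> enorm x <= a -> cutoff a eps x = 1.
Proof.
move=> e0 xa; have e20 : 0 < eps / 2 by rewrite divr_gt0.
rewrite /cutoff /Rintegral -[RHS]/(fine 1) -(integral_scaled_mollifier x e20).
congr fine; apply: eq_integral => y _; congr EFin.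
have [xy|xy] := ltP (enorm (x - y)) (eps / 2); last first.
  by rewrite scaled_mollifier_eq0// mul0r.
rewrite indicE mem_set ?mulr1// /eball /=.
have -> : y = x + (-1) *: (x - y) by rewrite scaleN1r opprB addrC subrK.
apply: (le_lt_trans (enorm_triangle _ _)).
by rewrite enormZ normrN1 mul1r ler_ltD.
Qed.

Lemma cutoff_eq0 a eps x : 0 < eps -> a + eps <= enorm x -> cutoff a eps x = 0.
Proof.
move=> e0 xa; have e20 : 0 < eps / 2 by rewrite divr_gt0.
rewrite /cutoff /Rintegral integral0_eq// => y _; congr EFin.
have [xy|xy] := ltP (enorm (x - y)) (eps / 2); last first.
  by rewrite scaled_mollifier_eq0// mul0r.
rewrite indicE memNset ?mulr0// /eball /= => ya.
suff : enorm x < a + eps by rewrite ltNge xa.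
rewrite -(subrK y x) (splitr eps) addrA.
apply: (le_lt_trans (enorm_triangle _ _)); rewrite addrC.
exact: ltrD.
Qed.

(** On the sphere itself the cutoffs are 1 whereas the indicator of the open
    ball is 0: the sphere has to be excluded. *)
Lemma cvg_cutoff a (eps : nat -> R) x :
  (forall k, 0 < eps k) -> eps @ \oo --> (0 : R) -> enorm x != a ->
  cutoff a (eps k) x @[k --> \oo] --> (\1_(eball a) x : R).
Proof.
move=> eps0 cvg_eps xa.
have [x_lt|a_le] := ltP (enorm x) a.
  rewrite indicE mem_set//; apply: cvg_near_cst; apply: nearW => k.
  by rewrite cutoff_eq1// ltW.
have a_lt : 0 < enorm x - a by rewrite subr_gt0 lt_neqAle eq_sym xa.
rewrite indicE memNset; last by rewrite /eball /= ltNge a_le.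
apply: cvg_near_cst.
near=> k; rewrite cutoff_eq0// -lerBrDl ltW//.
near: k; exact: (cvgr_lt 0 cvg_eps _ a_lt).
Unshelve. all: by end_near.
Qed.

End cutoff.

(** * Convergence in L^2 *)

Section bounded_multipliers.
Context {disp : measure_display} {T : measurableType disp} {R : realType}.
Variable mu : {measure set T -> \bar R}.

(** The integrand is at most twice [(Qk k * (uk k - u)) ^+ 2] plus twice
    [((Qk k - Q) * u) ^+ 2]: the bound on [Qk] handles the former, dominated
    convergence with the majorant [(2 * C) ^+ 2 * u ^+ 2] the latter. *)
Lemma cvg_bounded_mul_L2 (C : R) (Q : T -> R) (Qk : nat -> T -> R)
    (u : T -> R) (uk : nat -> T -> R) :
  measurable_fun setT Q -> (forall k, measurable_fun setT (Qk k)) ->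
  measurable_fun setT u -> (forall k, measurable_fun setT (uk k)) ->
  (forall x, `|Q x| <= C) -> (forall k x, `|Qk k x| <= C) ->
  {ae mu, forall x, Qk k x @[k --> \oo] --> Q x} ->
  mu.-integrable setT (fun x => (u x ^+ 2)%:E) ->
  (\int[mu]_x ((uk k x - u x) ^+ 2)%:E)%E @[k --> \oo] --> 0%E ->
  (\int[mu]_x ((Qk k x * uk k x - Q x * u x) ^+ 2)%:E)%E @[k --> \oo] --> 0%E.
Proof.
move=> mQ mQk mu_ muk QC QkC QkQ iu uku.
have msqr (f : T -> R) : measurable_fun setT f ->
    measurable_fun setT (fun x => (f x ^+ 2)%:E).
  by move=> mf; apply/measurable_EFinP; exact: measurable_funX.
have mdiff k : measurable_fun setT (fun x => ((Qk k x - Q x) ^+ 2 * u x ^+ 2)%:E).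
  apply/measurable_EFinP; apply: measurable_funM; apply: measurable_funX => //.
  exact: measurable_funB.
have prod_ge0 k x : 0 <= (Qk k x - Q x) ^+ 2 * u x ^+ 2.
  by rewrite mulr_ge0 ?sqr_ge0.
have C2_ge0 : 0 <= 2 * C ^+ 2 by rewrite mulr_ge0 ?sqr_ge0.
have dom : (\int[mu]_x ((Qk k x - Q x) ^+ 2 * u x ^+ 2)%:E)%E @[k --> \oo]
    --> 0%E.
  have [] := @dominated_convergence _ _ _ mu setT measurableT
    (fun k x => ((Qk k x - Q x) ^+ 2 * u x ^+ 2)%:E) (cst 0%E)
    (fun x => ((2 * C) ^+ 2)%:E * (u x ^+ 2)%:E)%E mdiff.
  - exact: measurable_cst.
  - apply: filterS QkQ => x Qx _.
    rewrite -[X in _ --> X]/((0 : R)%:E); apply: cvg_EFin; first exact: nearW.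
    have -> : (0 : R) = (Q x - Q x) ^+ 2 * u x ^+ 2 by rewrite subrr expr0n mul0r.
    apply: cvgM; last exact: cvg_cst.
    rewrite expr2; under eq_fun do rewrite expr2.
    by apply: cvgM; (apply: cvgB => //; exact: cvg_cst).
  - exact: integrableZl.
  - apply: aeW => x k _; rewrite gee0_abs; last first.
      by rewrite lee_fin; exact: prod_ge0.
    rewrite lee_fin ler_wpM2r ?sqr_ge0// -real_normK ?num_real//.
    rewrite lerXn2r ?nnegrE ?normr_ge0//.
      by rewrite mulr_ge0// (le_trans (normr_ge0 _) (QC x)).
    by rewrite (le_trans (ler_normB _ _))// mulr_natl mulr2n lerD.
  - by move=> _ _; rewrite integral0.
pose bnd k := ((2 * C ^+ 2)%:E * \int[mu]_x ((uk k x - u x) ^+ 2)%:E +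
  2%:E * \int[mu]_x ((Qk k x - Q x) ^+ 2 * u x ^+ 2)%:E)%E.
apply: (@squeeze_cvge _ _ _ _ (cst 0%E) _ bnd).
- apply: nearW => k; apply/andP; split.
    by apply: integral_ge0 => x _; rewrite lee_fin sqr_ge0.
  rewrite /bnd -[in X in (_ <= X + _)%E]ge0_integralZl//; last 2 first.
  - by apply: msqr; exact: measurable_funB.
  - by move=> x _; rewrite lee_fin sqr_ge0.
  rewrite -[in X in (_ <= _ + X)%E]ge0_integralZl//; last first.
    by move=> x _; rewrite lee_fin; exact: prod_ge0.
  rewrite -ge0_integralD//; last 4 first.
  - by move=> x _; apply: mule_ge0; rewrite lee_fin// sqr_ge0.
  - by apply: measurable_funeM; apply: msqr; exact: measurable_funB.
  - by move=> x _; apply: mule_ge0; rewrite lee_fin//; exact: prod_ge0.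
  - exact: measurable_funeM.
  apply: ge0_le_integral => //.
  - by move=> x _; rewrite lee_fin sqr_ge0.
  - by apply: msqr; apply: measurable_funB; exact: measurable_funM.
  - apply: emeasurable_funD; apply: measurable_funeM => //.
    by apply: msqr; exact: measurable_funB.
  - move=> x _; rewrite -!EFinM -EFinD lee_fin.
    have QC2 : Qk k x ^+ 2 <= C ^+ 2.
      rewrite -real_normK ?num_real// lerXn2r ?nnegrE//.
      exact: le_trans (normr_ge0 _) (QC x).
    have := ler_wpM2r (sqr_ge0 (uk k x - u x)) QC2.
    (* (s + t)^2 <= 2 s^2 + 2 t^2 amounts to (s - t)^2 >= 0. *)
    have := sqr_ge0 (Qk k x * (uk k x - u x) - (Qk k x - Q x) * u x).
    lra.
- exact: cvg_cst.
- rewrite -[0%E]adde0 -{1}[0%E](mule0 (2 * C ^+ 2)%:E) -{2}[0%E](mule0 2%:E).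
  by apply: cvgeD => //; apply: cvgeZl.
Qed.

End bounded_multipliers.

Section L2_square.
Context {R : realType} {d : nat}.
Local Notation mu := (lebesgue_rV R d).
Implicit Types f g : 'rV[R]_d -> R[i].
Local Notation normc := ComplexField.Normc.normc.

Lemma sqr_normcE (z : R[i]) :
  normc z ^+ 2 = complex.Re z ^+ 2 + complex.Im z ^+ 2.
Proof. by case: z => x y /=; rewrite sqr_sqrtr// addr_ge0 ?sqr_ge0. Qed.

Lemma L2normE f :
  L2norm f = ((\int[mu]_x (normc (f x) ^+ 2)%:E) `^ 2^-1)%E.
Proof.
rewrite /L2norm unlock; congr (_ `^ _)%E; apply: eq_integral => x _.
by rewrite /= powR_mulrn// real_normK ?num_real.
Qed.

(** The norm is the square root of this integral, also when the integral is
    infinite. *)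
Lemma L2cvg_sqrP (fk : nat -> 'rV[R]_d -> R[i]) f :
  L2cvg fk f <->
  (\int[mu]_x (normc (fk k x - f x) ^+ 2)%:E)%E @[k --> \oo] --> 0%E.
Proof.
rewrite /L2cvg; under eq_fun do rewrite L2normE.
set q := fun k : nat => (\int[mu]_x (normc (fk k x - f x) ^+ 2)%:E)%E.
have q0 k : (0 <= q k)%E by apply: integral_ge0 => x _; rewrite lee_fin sqr_ge0.
have sqrtq k : q k \is a fin_num -> (q k `^ 2^-1 = (Num.sqrt (fine (q k)))%:E)%E.
  by move=> qfin; rewrite -{1}(fineK qfin) poweR_EFin powR12_sqrt ?fine_ge0.
split => [q_cvg|/fine_cvgP[qfin q_cvg]].
  have -> : q = (fun k => q k `^ 2^-1 * q k `^ 2^-1)%E.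
    apply/funext => k; have [qy|qy] := eqVneq (q k) +oo%E.
      by rewrite qy poweRyr ?mulyy// invr_eq0.
    have qfin : q k \is a fin_num by rewrite ge0_fin_numE// ltey.
    by rewrite sqrtq// -EFinM -expr2 sqr_sqrtr ?fine_ge0// fineK.
  by rewrite -[0%E](mule0 0%E); apply: cvgeM => //; rewrite mule_def_fin.
have : (Num.sqrt (fine (q k)))%:E @[k --> \oo] --> 0%E.
  apply: cvg_EFin; first exact: nearW.
  rewrite -[0]sqrtr0; apply: continuous_cvg => //; exact: sqrt_continuous.
apply: cvg_trans; apply: near_eq_cvg.
by apply: filterS qfin => k qfin; rewrite sqrtq.
Qed.

Lemma L2_measurable f : L2 f ->
  measurable_fun setT (fun x => complex.Re (f x)) /\
  measurable_fun setT (fun x => complex.Im (f x)).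
Proof.
by move=> [] /sub_Lfun_mfun; rewrite inE/= => mRe /sub_Lfun_mfun; rewrite inE.
Qed.

Lemma measurable_sqr_normcB f g : L2 f -> L2 g ->
  measurable_fun setT (fun x => normc (f x - g x) ^+ 2).
Proof.
move=> /L2_measurable[mRef mImf] /L2_measurable[mReg mImg].
have -> : (fun x => normc (f x - g x) ^+ 2) =
    (fun x => (complex.Re (f x) - complex.Re (g x)) ^+ 2 +
              (complex.Im (f x) - complex.Im (g x)) ^+ 2).
  by apply/funext => x; rewrite sqr_normcE !raddfB.
by apply: measurable_funD; apply: measurable_funX; exact: measurable_funB.
Qed.

End L2_square.

(** * Eigenfunctions *)

Section eigenfunction.
Context {R : realType} {d : nat} {m alpha : R}.
Local Notation mu := (lebesgue_rV R d).

Lemma multiplier_graphP (s : 'rV[R]_d -> R) u :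
  multiplier_dom s u -> multiplier_graph s u (multiplier s u).
Proof. exact: xgetPex. Qed.

Lemma L2_multiplier (s : 'rV[R]_d -> R) u :
  multiplier_dom s u -> L2 (multiplier s u).
Proof. by move=> /multiplier_graphP[U _ []]. Qed.

Lemma L2_multiplier_dom (s : 'rV[R]_d -> R) u : multiplier_dom s u -> L2 u.
Proof. by move=> [w [U []]]. Qed.

(** The equation [lam u = Phi(-Delta) u + V u], solved for the operator. *)
Lemma eigenfunction_PhiLaplacian (V : 'rV[R]_d -> R) (lam : R)
    (u : 'rV[R]_d -> R) :
  L2_eigenspace (hamiltonian m alpha V) lam%:C%C (RtoC u) ->
  PhiLaplacian m alpha (RtoC u) = RtoC (fun x => (lam - V x) * u x) %[ae mu].
Proof.
move=> [_ _]; apply: filterS => x /(_ I) eqx _.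
have {eqx} -> : PhiLaplacian m alpha (RtoC u) x =
    (lam%:C%C * RtoC u x - (V x)%:C%C * RtoC u x)%R.
  by rewrite eqx addrK.
by rewrite /RtoC -!rmorphM -rmorphB mulrBl.
Qed.

End eigenfunction.

Unset Implicit Arguments.

Theorem theorem4p1 (R : realType) (d : nat) (alpha m v a : R)
    (phi : 'rV[R]_d -> R) (lam : R)
    (eps : nat -> R) (phik : nat -> 'rV[R]_d -> R) (lamk : nat -> R) :
  (0 < d)%N -> 0 < alpha < 2 -> 0 <= m -> 0 < v -> 0 < a ->
  ground_state (hamiltonian m alpha (well v a)) lam phi ->
  (forall k, 0 < eps k) -> nonincreasing_seq eps -> eps @ \oo --> (0 : R) ->
  (forall k, ground_state (hamiltonian m alpha (smooth_well v a (eps k)))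
               (lamk k) (phik k)) ->
  L2cvg (fun k => RtoC (phik k)) (RtoC phi) ->
  {ae lebesgue_rV R d, forall x, phik k x @[k --> \oo] --> phi x} ->
  lamk @ \oo --> lam ->
  [/\ PhiLaplacian_dom m alpha (RtoC phi),
      L2 (PhiLaplacian m alpha (RtoC phi)),
      (forall k, PhiLaplacian_dom m alpha (RtoC (phik k))) &
      L2cvg (fun k => PhiLaplacian m alpha (RtoC (phik k)))
            (PhiLaplacian m alpha (RtoC phi))].
Proof.
move=> d_gt0 _ _ v_gt0 _ [_ _ [eig _ _ _]] eps_gt0 _ cvg_eps gsk cvg_phik _.
move=> cvg_lamk.
have eigk k : L2_eigenspace (hamiltonian m alpha (smooth_well v a (eps k)))
    (lamk k)%:C%C (RtoC (phik k)) by have [_ _ []] := gsk k.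
have dom : PhiLaplacian_dom m alpha (RtoC phi) by have [] := eig.
have domk k : PhiLaplacian_dom m alpha (RtoC (phik k)) by have [] := eigk k.
split => //; first exact: L2_multiplier.
have mphi : measurable_fun setT phi.
  by have [] := L2_measurable (L2_multiplier_dom dom).
have mphik k : measurable_fun setT (phik k).
  by have [] := L2_measurable (L2_multiplier_dom (domk k)).
pose Q (x : 'rV[R]_d) := lam - well v a x.
pose Qk k (x : 'rV[R]_d) := lamk k - smooth_well v a (eps k) x.
have mQ : measurable_fun setT Q.
  apply: measurable_funB => //; apply: measurable_funM => //.
  by apply/measurable_indicP; exact: measurable_eball.
have mQk k : measurable_fun setT (Qk k).
  apply: measurable_funB => //; apply: measurable_funM => //.
  exact: measurable_cutoff.
have [M lamM lamkM] : exists2 M, `|lam| <= M & forall k, `|lamk k| <= M.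
  have /cvg_seq_bounded : cvgn lamk by apply/cvg_ex; exists lam.
  move=> [M [_ /(_ (M + 1))]]; rewrite ltrDl ltr01 => /(_ isT) lamkM.
  exists (Num.max (M + 1) `|lam|) => [|k]; rewrite le_max ?lexx ?orbT//.
  by rewrite lamkM.
have QC x : `|Q x| <= M + v.
  rewrite (le_trans (ler_normB _ _))// lerD//.
  rewrite /well normrM normrN (gtr0_norm v_gt0).
  rewrite ler_piMr ?(ltW v_gt0)// indicE.
  by case: (_ \in _); rewrite ?normr1 ?normr0.
have QkC k x : `|Qk k x| <= M + v.
  rewrite (le_trans (ler_normB _ _))// lerD//.
  rewrite /smooth_well normrM normrN (gtr0_norm v_gt0).
  by rewrite ler_piMr ?(ltW v_gt0)// ger0_norm ?cutoff_le1 ?cutoff_ge0.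
have cvgQ : {ae lebesgue_rV R d, forall x, Qk k x @[k --> \oo] --> Q x}.
  exists [set x | enorm x = a]; split.
  - exact: measurable_sphere.
  - exact: sphere_null.
  - move=> x; apply: contra_notP => /= /eqP xa.
    apply: cvgB => //; apply: cvgM; first exact: cvg_cst.
    exact: cvg_cutoff.
have sqr_phi : (lebesgue_rV R d).-integrable setT (fun x => (phi x ^+ 2)%:E).
  by have [/Lfun2_integrable_sqr] := L2_multiplier_dom dom.
have sqr_cvg : (\int[lebesgue_rV R d]_x ((phik k x - phi x) ^+ 2)%:E)%E
    @[k --> \oo] --> 0%E.
  rewrite [X in X @ _ --> _](_ : _ = fun k => (\int[lebesgue_rV R d]_x
      (ComplexField.Normc.normc (RtoC (phik k) x - RtoC phi x) ^+ 2)%:E)%E).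
    exact/L2cvg_sqrP.
  apply/funext => k; apply: eq_integral => x _; congr EFin.
  by rewrite sqr_normcE /RtoC -rmorphB /= expr0n addr0.
apply/L2cvg_sqrP.
rewrite [X in X @ _ --> _](_ : _ = fun k => (\int[lebesgue_rV R d]_x
    ((Qk k x * phik k x - Q x * phi x) ^+ 2)%:E)%E).
  exact: (cvg_bounded_mul_L2 mQ mQk mphi mphik QC QkC cvgQ sqr_phi sqr_cvg).
apply/funext => k.
apply: ge0_ae_eq_integral => //.
- apply/measurable_EFinP.
  exact: measurable_sqr_normcB (L2_multiplier (domk k)) (L2_multiplier dom).
- apply/measurable_EFinP; apply: measurable_funX; apply: measurable_funB;
    by apply: measurable_funM.
- by move=> x _; rewrite lee_fin sqr_ge0.
- by move=> x _; rewrite lee_fin sqr_ge0.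
apply: filterS2 (eigenfunction_PhiLaplacian eig)
  (eigenfunction_PhiLaplacian (eigk k)) => x /(_ I) -> /(_ I) -> _.
by rewrite sqr_normcE /RtoC -rmorphB /= expr0n addr0.
Qed.
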